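(* Consider the following eventually periodic sequences in $\mathbb{Z}/4\mathbb{Z}$: $S_1 = 01220232(212113220030232311200232)^{\infty}$, $S_2 = 21210130(200132022112002110220130)^{\infty}$, $T_1 = 0120021(212202102023032200322021)^{\infty}$, $T_2 = 1000212(312223301210312003103232)^{\infty}$, $T_3 = 1200210(220101222032222103000210)^{\infty}$, $T_4 = 2102203(232002102021230022302203)^{\infty}$. Their generating functions $\mathcal{G}_S(t)$ (for lifting from $\mathbb{Z}/4\mathbb{Z}$ to $\mathbb{Z}/8\mathbb{Z}$) are the following polynomials: $\mathcal{G}_{S_1}(t) = 1 + 16t^{16} + 46t^{32} + 32t^{48} + 14t^{64}$, $\mathcal{G}_{S_2}(t) = 1 + 22t^{16} + 60t^{32} + 56t^{48} + 28t^{64} + 6t^{80}$, $\mathcal{G}_{T_1}(t) = 14t^{15} + 40t^{31} + 40t^{47} + 24t^{63} + 8t^{79} + 2t^{95} + 2t^{111}$, $\mathcal{G}_{T_2}(t) = 30t^{15} + 66t^{31} + 76t^{47} + 32t^{63} + 12t^{79}$, $\mathcal{G}_{T_3}(t) = 14t^{15} + 54t^{31} + 42t^{47} + 34t^{63} + 12t^{79} + 2t^{95}$, $\mathcal{G}_{T_4}(t) = 14t^{15} + 54t^{31} + 64t^{47} + 40t^{63} + 10t^{79} + 2t^{95}$.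
   Context: For a finite sequence $S=(x_{1,1},\dots,x_{1,n})$ in $\mathbb{Z}/N\mathbb{Z}$, the Steinhaus triangle $\nabla S$ is the triangular array $(x_{i,j})_{1\le i\le n,\,1\le j\le n+1-i}$ with $x_{i+1,j}=x_{i,j}+x_{i,j+1}$ mod $N$; it is balanced if all elements of $\mathbb{Z}/N\mathbb{Z}$ occur in it with equal multiplicity. $S[l]$ denotes the initial segment of length $l$ of a sequence $S$. For even $N$, $\nabla S$ with $S$ of length $n$ is strongly balanced if $\nabla S[n-2Nt]$ is balanced for every integer $0\le t\le n/(2N)$ (the empty triangle counts as balanced). Let $m$ be even and $\pi:\mathbb{Z}/2m\mathbb{Z}\to\mathbb{Z}/m\mathbb{Z}$ the canonical quotient map. For an infinite sequence $S$ in $\mathbb{Z}/m\mathbb{Z}$ and $n\ge0$, $a_n(S)$ is the number of sequences $T$ of length $n$ in $\mathbb{Z}/2m\mathbb{Z}$ such that $\nabla T$ is strongly balanced in $\mathbb{Z}/2m\mathbb{Z}$ and $\pi(T)=S[n]$ (termwise), and $\mathcal{G}_S(t)=\sum_{n\ge0}a_n(S)t^n$. Here $m=4$, so the lifts are to $\mathbb{Z}/8\mathbb{Z}$ and strong balance there refers to the segments $T[n-16t]$. $(W)^\infty$ denotes infinite repetition of the word $W$.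
   Formalization: The generating functions of T_1, T_2, T_3 and T_4 are stated with an added constant term 1, since the empty sequence is a strongly balanced lift of length 0 and so a_0(S)=1 for every S; the printed polynomials omit it. *)

(* Defs.v *)
From mathcomp Require Import all_boot all_order all_algebra.

Set Implicit Arguments.
Unset Strict Implicit.
Unset Printing Implicit Defensive.

Import GRing.Theory.
Local Open Scope ring_scope.

(* All indices are shifted by one: rows and columns start at 0, so that the
   triangle of a sequence of length n consists of the (i, j) with i + j < n.
   'Z_N is the ring Z/NZ only for N > 1. *)
Fixpoint steinhaus (N : nat) (x : nat -> 'Z_N) (i j : nat) : 'Z_N :=
  if i is i'.+1 then steinhaus x i' j + steinhaus x i' j.+1 else x j.

Definition multiplicity (N : nat) (s : seq 'Z_N) (a : 'Z_N) : nat :=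
  #|[set p : 'I_(size s) * 'I_(size s) |
      (p.1 + p.2 < size s)%N && (steinhaus (nth 0 s) p.1 p.2 == a)]|.

Definition balanced (N : nat) (s : seq 'Z_N) : bool :=
  [forall a : 'Z_N, forall b : 'Z_N, multiplicity s a == multiplicity s b].

(* For N > 0, the integers 0 <= t <= n / (2N) are the t < n + 1 with
   2 N t <= n; here n = size s. *)
Definition strongly_balanced (N : nat) (s : seq 'Z_N) : bool :=
  [forall t : 'I_(size s).+1, (2 * N * t <= size s)%N ==>
     balanced (take (size s - 2 * N * t) s)].

Definition Zquot (m : nat) (x : 'Z_(2 * m)) : 'Z_m := inZp x.

Definition num_lifts (m : nat) (S : nat -> 'Z_m) (n : nat) : nat :=
  #|[set T : n.-tuple 'Z_(2 * m) |
      strongly_balanced T && (map (@Zquot m) T == mkseq S n)]|.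

(* Formal power series over the integers, represented by their sequences of
   coefficients, and the embedding of polynomials into them. *)
Definition fps : Type := nat -> int.

Definition fps_of_poly (p : {poly int}) : fps := fun n => p`_n.

(* The constant term is 1 for every S: the empty sequence is its own unique
   lift, and the empty triangle is strongly balanced. *)
Definition genfun (m : nat) (S : nat -> 'Z_m) : fps :=
  fun n => (num_lifts S n)%:Z.

(* The infinite sequence u w w w ... *)
Definition preperiodic (m : nat) (u w : seq 'Z_m) (k : nat) : 'Z_m :=
  if (k < size u)%N then nth 0 u k else nth 0 w ((k - size u) %% size w).

Definition S1 : nat -> 'Z_4 :=
  preperiodic
    [:: 0; 1; 2; 2; 0; 2; 3; 2]
    [:: 2; 1; 2; 1; 1; 3; 2; 2; 0; 0; 3; 0;
        2; 3; 2; 3; 1; 1; 2; 0; 0; 2; 3; 2].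

Definition S2 : nat -> 'Z_4 :=
  preperiodic
    [:: 2; 1; 2; 1; 0; 1; 3; 0]
    [:: 2; 0; 0; 1; 3; 2; 0; 2; 2; 1; 1; 2;
        0; 0; 2; 1; 1; 0; 2; 2; 0; 1; 3; 0].

Definition T1 : nat -> 'Z_4 :=
  preperiodic
    [:: 0; 1; 2; 0; 0; 2; 1]
    [:: 2; 1; 2; 2; 0; 2; 1; 0; 2; 0; 2; 3;
        0; 3; 2; 2; 0; 0; 3; 2; 2; 0; 2; 1].

Definition T2 : nat -> 'Z_4 :=
  preperiodic
    [:: 1; 0; 0; 0; 2; 1; 2]
    [:: 3; 1; 2; 2; 2; 3; 3; 0; 1; 2; 1; 0;
        3; 1; 2; 0; 0; 3; 1; 0; 3; 2; 3; 2].

Definition T3 : nat -> 'Z_4 :=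
  preperiodic
    [:: 1; 2; 0; 0; 2; 1; 0]
    [:: 2; 2; 0; 1; 0; 1; 2; 2; 2; 0; 3; 2;
        2; 2; 2; 1; 0; 3; 0; 0; 0; 2; 1; 0].

Definition T4 : nat -> 'Z_4 :=
  preperiodic
    [:: 2; 1; 0; 2; 2; 0; 3]
    [:: 2; 3; 2; 0; 0; 2; 1; 0; 2; 0; 2; 1;
        2; 3; 0; 0; 2; 2; 3; 0; 2; 2; 0; 3].

(* Main.v *)
(* The lifts of S are the sequences s + 4t with s a fixed lift and t binary, and the
   triangle of s + 4t is that of s with the top bits flipped by the triangle of t
   over F_2. Strongly balanced lifts of length n have n = 0 or 15 modulo 16, and
   each restricts to one of length n - 16, so they form a tree in which all
   children of a node are found among 2^16 candidates; since the tree is finite,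
   it suffices to compute its levels.

   The search below a node is cheap because, 16 being a power of 2, the flips that 16
   new bits cause in the 16 new antidiagonals are 16-periodic in the row index:
   the number of entries a + 4 is a sum of table values indexed by flip patterns
   that do not depend on the node. Balance requires these numbers to be 1/8 of the
   size of the block, first modulo 2, which is an affine condition on the new bits,
   then modulo 16, then exactly. *)
From HB Require Import structures.
Require Import Defs.
From mathcomp Require Import all_boot all_order all_algebra.

Set Implicit Arguments.
Unset Strict Implicit.
Unset Printing Implicit Defensive.

(** * Arithmetic tables *)

(* Elements of Z/8 (the triangle entries, via [add8]), elements of Z/16 (the
   counters, via [hadd]) and blocks of four bits (via [hbits]) are all encoded by
   this enumeration, so that each operation is one table lookup. *)
Inductive hex :=
  h0 | h1 | h2 | h3 | h4 | h5 | h6 | h7 | h8 | h9 | hA | hB | hC | hD | hE | hF.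

Definition hexes :=
  [:: h0; h1; h2; h3; h4; h5; h6; h7; h8; h9; hA; hB; hC; hD; hE; hF].

Definition octits := [:: h0; h1; h2; h3; h4; h5; h6; h7].

Definition tabulate T (f : hex -> T) (x : hex) : T :=
  match x with
  | h0 => f h0 | h1 => f h1 | h2 => f h2 | h3 => f h3
  | h4 => f h4 | h5 => f h5 | h6 => f h6 | h7 => f h7
  | h8 => f h8 | h9 => f h9 | hA => f hA | hB => f hB
  | hC => f hC | hD => f hD | hE => f hE | hF => f hF
  end.

Definition hval (x : hex) : nat :=
  match x with
  | h0 => 0 | h1 => 1 | h2 => 2 | h3 => 3 | h4 => 4 | h5 => 5 | h6 => 6 | h7 => 7
  | h8 => 8 | h9 => 9 | hA => 10 | hB => 11 | hC => 12 | hD => 13 | hE => 14 | hF => 15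
  end.

Definition hex_of_nat (n : nat) : hex := nth h0 hexes (n %% 16).

Definition hadd := Eval compute in
  tabulate (fun x => tabulate (fun y => hex_of_nat (hval x + hval y))).
Definition add8 := Eval compute in
  tabulate (fun x => tabulate (fun y => hex_of_nat ((hval x + hval y) %% 8))).
Definition eq8 := Eval compute in
  tabulate (fun x => tabulate (fun y => hval x %% 8 == hval y %% 8)).

Definition hbits := Eval compute in
  tabulate (fun x => [:: odd (hval x); odd (hval x %/ 2); odd (hval x %/ 4); odd (hval x %/ 8)]).
Definition hex_of_bits (a b c d : bool) : hex := hex_of_nat (a + 2 * b + 4 * c + 8 * d).

Definition hxor (x y : hex) : hex :=
  match hbits x, hbits y with
  | [:: a; b; c; d], [:: a'; b'; c'; d'] =>
      hex_of_bits (a (+) a') (b (+) b') (c (+) c') (d (+) d')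
  | _, _ => h0
  end.

Definition is_h0 (x : hex) : bool := if x is h0 then true else false.

Lemma hval_add x y : hval (hadd x y) = (hval x + hval y) %% 16.
Proof. by case: x; case: y. Qed.

Lemma hval_mod x : hval x %% 16 = hval x.
Proof. by case: x. Qed.

Lemma is_h0E x : is_h0 x = (hval x == 0).
Proof. by case: x. Qed.

Lemma hval_hex_of_nat n : hval (hex_of_nat n) = n %% 16.
Proof.
rewrite /hex_of_nat; have : n %% 16 < 16 by rewrite ltn_mod.
by move: (n %% 16); do 16?case=> //.
Qed.

Lemma hvalK : cancel hval hex_of_nat.
Proof. by case. Qed.

HB.instance Definition _ := Equality.copy hex (can_type hvalK).

Inductive quad T := Quad of T & T & T & T.

Definition qmap A B (f : A -> B) (q : quad A) : quad B :=
  let: Quad a b c d := q in Quad (f a) (f b) (f c) (f d).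

(* Unlike [tabulate f], the closure [memo f] evaluates each value of [f] at most
   once, under call-by-value and under call-by-need. *)
Definition memo T (f : hex -> T) : hex -> T :=
  let v0 := f h0 in let v1 := f h1 in let v2 := f h2 in let v3 := f h3 in
  let v4 := f h4 in let v5 := f h5 in let v6 := f h6 in let v7 := f h7 in
  let v8 := f h8 in let v9 := f h9 in let vA := f hA in let vB := f hB in
  let vC := f hC in let vD := f hD in let vE := f hE in let vF := f hF in
  fun x => match x with
  | h0 => v0 | h1 => v1 | h2 => v2 | h3 => v3 | h4 => v4 | h5 => v5 | h6 => v6 | h7 => v7
  | h8 => v8 | h9 => v9 | hA => vA | hB => vB | hC => vC | hD => vD | hE => vE | hF => vF
  end.

Lemma memoE T (f : hex -> T) x : memo f x = f x.
Proof. by case: x. Qed.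

(** * Counting along one antidiagonal *)

(* In the sequences [D], [Some t] stands for an entry of a fixed class modulo 4
   whose top bit is [t], and [None] for an entry of another class; [hits c D] is
   the number of entries of that class whose top bit is 1 after flipping the
   top bits by [c]. *)
Fixpoint hits (c : nat -> bool) (D : seq (option bool)) : nat :=
  if D is o :: D' then
    (if o is Some t then t (+) c 0 else false) + hits (fun i => c i.+1) D'
  else 0.

Lemma eq_hits c c' D : c =1 c' -> hits c D = hits c' D.
Proof.
elim: D c c' => //= o D IH c c' e; rewrite e; congr (_ + _).
by apply: IH => i; rewrite e.
Qed.

(* The two counters of a residue class of positions: entries with top bit 0, which
   are hits when flipped, and entries with top bit 1. *)
Definition tally (o : option bool) (c : hex * hex) : hex * hex :=
  match o with
  | Some true => (c.1, hadd h1 c.2)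
  | Some false => (hadd h1 c.1, c.2)
  | None => c
  end.

Definition qtally o0 o1 o2 o3 (q : quad (hex * hex)) : quad (hex * hex) :=
  let: Quad c0 c1 c2 c3 := q in Quad (tally o0 c0) (tally o1 c1) (tally o2 c2) (tally o3 c3).

Definition no_tally : quad (hex * hex) := Quad (h0, h0) (h0, h0) (h0, h0) (h0, h0).

(* The positions modulo 16, in four blocks of four: prepending four entries
   rotates the blocks. *)
Fixpoint residue_tallies (D : seq (option bool)) : quad (quad (hex * hex)) :=
  match D with
  | o0 :: o1 :: o2 :: o3 :: D' =>
      let: Quad x y z t := residue_tallies D' in Quad (qtally o0 o1 o2 o3 t) x y z
  | _ =>
      Quad (qtally (nth None D 0) (nth None D 1) (nth None D 2) None no_tally)
           no_tally no_tally no_tally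
  end.

Definition pick (c : hex * hex) (b : bool) : hex := if b then c.1 else c.2.

Definition block_table (q : quad (hex * hex)) : hex -> hex :=
  let: Quad c0 c1 c2 c3 := q in
  memo (fun p => if hbits p is [:: a; b; c; d] then
    hadd (pick c0 a) (hadd (pick c1 b) (hadd (pick c2 c) (pick c3 d))) else h0).

Definition table (D : seq (option bool)) : quad (hex -> hex) :=
  qmap block_table (residue_tallies D).

Definition table_add (w : quad (hex -> hex)) (p : quad hex) (s : hex) : hex :=
  let: Quad w0 w1 w2 w3 := w in let: Quad p0 p1 p2 p3 := p in
  hadd (w0 p0) (hadd (w1 p1) (hadd (w2 p2) (hadd (w3 p3) s))).

Definition periodic (p : quad hex) (i : nat) : bool :=
  let: Quad p0 p1 p2 p3 := p in
  nth false (hbits p0 ++ hbits p1 ++ hbits p2 ++ hbits p3) (i %% 16).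

Lemma hbitsP p : exists a b c d, hbits p = [:: a; b; c; d].
Proof. by case: p; do 4!eexists; reflexivity. Qed.

Lemma periodic_rot p0 p1 p2 p3 i :
  periodic (Quad p0 p1 p2 p3) i.+4 = periodic (Quad p1 p2 p3 p0) i.
Proof.
rewrite /periodic -addn4 -modnDml.
have [? [? [? [? ->]]]] := hbitsP p0; have [? [? [? [? ->]]]] := hbitsP p1.
have [? [? [? [? ->]]]] := hbitsP p2; have [? [? [? [? ->]]]] := hbitsP p3.
have : i %% 16 < 16 by rewrite ltn_mod.
by move: (i %% 16); do 16?case=> //.
Qed.

Definition picks (q : quad (hex * hex)) (p : hex) : nat :=
  let: Quad c0 c1 c2 c3 := q in
  if hbits p is [:: a; b; c; d] then
    hval (pick c0 a) + hval (pick c1 b) + hval (pick c2 c) + hval (pick c3 d) else 0.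

Definition all_picks (q : quad (quad (hex * hex))) (p : quad hex) : nat :=
  let: Quad x y z t := q in let: Quad p0 p1 p2 p3 := p in
  picks x p0 + picks y p1 + picks z p2 + picks t p3.

Lemma hval_tally o c b :
  hval (pick (tally o c) b) = (hval (pick c b) + (if o is Some t then t (+) b else false)) %% 16.
Proof. by case: o c b => [[]|] [x y] []; case: x; case: y. Qed.

Lemma congr_addn d m m' n n' :
  m = m' %[mod d] -> n = n' %[mod d] -> m + n = m' + n' %[mod d].
Proof. by move=> em en; rewrite -modnDm em en modnDm. Qed.

Lemma picks_qtally o0 o1 o2 o3 q p c : (forall i, i < 4 -> c i = nth false (hbits p) i) ->
  picks (qtally o0 o1 o2 o3 q) p = picks q p + hits c [:: o0; o1; o2; o3] %[mod 16].
Proof.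
case: q => c0 c1 c2 c3 e; rewrite /= !e // addn0.
have [a0 [a1 [a2 [a3 ->]]]] := hbitsP p; rewrite !hval_tally /=.
rewrite !addnA [X in _ = X %[mod _]](ACl ((1 * 5) * (2 * 6) * (3 * 7) * (4 * 8))) /=.
by do 3?apply: congr_addn; rewrite modn_mod.
Qed.

Lemma hval_block_table q p : hval (block_table q p) = picks q p %% 16.
Proof.
case: q => c0 c1 c2 c3; rewrite -[block_table _]/(memo _) memoE /=.
by have [a [b [c [d ->]]]] := hbitsP p; rewrite !hval_add !(addnA, modnDmr).
Qed.

(** Prepending four entries moves the other positions up by four, one block of the pattern. The
    rotation of the tallies follows [periodic_rot], so the induction hypothesis is used at the
    rotated pattern. *)
Lemma all_picks_residue_tallies D p :
  all_picks (residue_tallies D) p = hits (periodic p) D %[mod 16].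
Proof.
have [n] := ubnP (size D); elim: n D p => // n IH D [p0 p1 p2 p3] leDn.
have per0 i : i < 4 -> periodic (Quad p0 p1 p2 p3) i = nth false (hbits p0) i.
  rewrite /periodic nth_cat; have [? [? [? [? ->]]]] := hbitsP p0.
  by case: i => [|[|[|[|i]]]].
(* Base case of fewer than four entries: the missing ones are [None], which is never a hit. *)
have short o0 o1 o2 : all_picks (Quad (qtally o0 o1 o2 None no_tally) no_tally no_tally no_tally)
    (Quad p0 p1 p2 p3) = hits (periodic (Quad p0 p1 p2 p3)) [:: o0; o1; o2] %[mod 16].
  have no_picks p : picks no_tally p = 0.
    by rewrite /picks /no_tally; have [[] [[] [[] [[] ->]]]] := hbitsP p.
  rewrite -[all_picks _ _]/(picks (qtally o0 o1 o2 None no_tally) p0 +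
    picks no_tally p1 + picks no_tally p2 + picks no_tally p3).
  by rewrite !no_picks !addn0 (picks_qtally _ _ _ _ _ per0) no_picks /= addn0.
case: D leDn => [|o0 [|o1 [|o2 [|o3 D]]]] leDn; try exact: short.
have ltDn : size D < n by exact: leq_trans (leq_addl 3 _) leDn.
have per4 : hits (fun i => periodic (Quad p0 p1 p2 p3) i.+4) D =
    hits (periodic (Quad p1 p2 p3 p0)) D by apply: eq_hits => i; rewrite periodic_rot.
have := IH D (Quad p1 p2 p3 p0) ltDn; rewrite -per4 [residue_tallies (_ :: _)]/=.
case: residue_tallies => x y z t.
set c := periodic _ in per0 *; set h := hits _ D.
move=> IHD.
have {}IHD : picks x p1 + picks y p2 + picks z p3 + picks t p0 = h %[mod 16] := IHD.
rewrite -[LHS]/((picks (qtally o0 o1 o2 o3 t) p0 + picks x p1 + picks y p2 + picks z p3) %% 16).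
have -> : hits c [:: o0, o1, o2, o3 & D] = hits c [:: o0; o1; o2; o3] + h.
  by rewrite /= !addn0 !addnA.
move: (hits c _) (picks_qtally o0 o1 o2 o3 t per0) => k pick4.
rewrite -!addnA (congr_addn pick4 (erefl _)) -(congr_addn (erefl (k %% 16)) IHD).
by congr (_ %% _); rewrite !addnA [LHS](ACl (2 * 3 * 4 * 5 * 1)).
Qed.

Lemma hval_table_add D p s :
  hval (table_add (table D) p s) = (hval s + hits (periodic p) D) %% 16.
Proof.
rewrite -modnDmr -all_picks_residue_tallies modnDmr /table.
case: (residue_tallies D) p => x y z t [p0 p1 p2 p3].
rewrite -[table_add _ _ _]/(hadd (block_table x p0) (hadd (block_table y p1)
  (hadd (block_table z p2) (hadd (block_table t p3) s)))).
rewrite -[all_picks _ _]/(picks x p0 + picks y p1 + picks z p2 + picks t p3).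
rewrite !hval_add !hval_block_table !modnDml; do 3!rewrite ?addnA modnDmr.
by rewrite !addnA [X in X = _ %[mod _]](ACl (5 * 1 * 2 * 3 * 4)).
Qed.

(** * The flips caused by new bits, and their periodicity *)

(** The Steinhaus rule modulo 2 along antidiagonals: [f] is the last antidiagonal and [b] the new
    term. *)
Fixpoint next_row (b : bool) (f : nat -> bool) (i : nat) : bool :=
  if i is i'.+1 then next_row b f i' (+) f i' else b.

(* If a binary sequence vanishes up to some index and continues with [rev rb], then
   [flip_row rb i] is the entry in row [i] of the last antidiagonal of its
   triangle. *)
Fixpoint flip_row (rb : seq bool) : nat -> bool :=
  if rb is b :: rb' then next_row b (flip_row rb') else fun=> false.

Lemma eq_next_row b f g : f =1 g -> next_row b f =1 next_row b g.
Proof. by move=> efg; elim=> //= i ->; rewrite efg. Qed.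

Lemma flip_rowS rb i : flip_row rb i.+1 = flip_row rb i (+) flip_row (behead rb) i.
Proof. by case: rb. Qed.

(* Over F_2, (1 + x)^(2^k) = 1 + x^(2^k). *)
Lemma flip_row_shift k rb i :
  flip_row rb (i + 2 ^ k) = flip_row rb i (+) flip_row (drop (2 ^ k) rb) i.
Proof.
elim: k rb i => [|k IH] rb i; first by rewrite addn1 flip_rowS drop1.
rewrite expnS mul2n -addnn addnA 3!IH drop_drop.
by rewrite addbA addbK.
Qed.

(** The correction term of the shift by 2^4 involves only bits beyond the sixteenth, and there are
    none. *)
Lemma flip_row_periodic rb i : size rb <= 16 -> flip_row rb (i + 16) = flip_row rb i.
Proof. by move=> le16; rewrite (flip_row_shift 4) drop_oversize //= addbF. Qed.

Lemma flip_row_modn rb i : size rb <= 16 -> flip_row rb (i %% 16) = flip_row rb i.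
Proof.
move=> le16; rewrite [in RHS](divn_eq i 16) addnC.
by elim: (i %/ 16) => [|q IH]; rewrite ?addn0 // mulSn [16 + _]addnC addnA flip_row_periodic.
Qed.

(** [next_row] forms prefix sums over F_2, taken here four rows at a time; the carry is the bit that
    enters the next block. *)
Definition block_step := Eval compute in fun b : bool =>
  if b then tabulate (fun p => if hbits p is [:: x; y; z; _]
    then hex_of_bits true (true (+) x) (true (+) x (+) y) (true (+) x (+) y (+) z) else h0)
  else tabulate (fun p => if hbits p is [:: x; y; z; _]
    then hex_of_bits false x (x (+) y) (x (+) y (+) z) else h0).

Definition block_carry := Eval compute in fun b : bool =>
  if b then tabulate (fun p => foldl addb true (hbits p))
  else tabulate (fun p => foldl addb false (hbits p)).

Definition next_pattern (b : bool) (p : quad hex) : quad hex :=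
  let: Quad p0 p1 p2 p3 := p in
  let c1 := block_carry b p0 in
  let c2 := block_carry c1 p1 in
  let c3 := block_carry c2 p2 in
  Quad (block_step b p0) (block_step c1 p1) (block_step c2 p2) (block_step c3 p3).

Lemma hbits_block_step b p x y z t : hbits p = [:: x; y; z; t] ->
  hbits (block_step b p) = [:: b; b (+) x; b (+) x (+) y; b (+) x (+) y (+) z].
Proof. by case: p => -[<- <- <- _]; case: b. Qed.

Lemma block_carryE b p x y z t : hbits p = [:: x; y; z; t] ->
  block_carry b p = b (+) x (+) y (+) z (+) t.
Proof. by case: p => -[<- <- <- <-]; case: b. Qed.

Lemma periodic_next_pattern b p i : i < 16 ->
  periodic (next_pattern b p) i = next_row b (periodic p) i.
Proof.
case: p => p0 p1 p2 p3; rewrite /periodic [next_pattern _ _]/=.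
have [x0 [y0 [z0 [t0 E0]]]] := hbitsP p0; have [x1 [y1 [z1 [t1 E1]]]] := hbitsP p1.
have [x2 [y2 [z2 [t2 E2]]]] := hbitsP p2; have [x3 [y3 [z3 [t3 E3]]]] := hbitsP p3.
rewrite (hbits_block_step _ E0) (hbits_block_step _ E1) (hbits_block_step _ E2).
rewrite (hbits_block_step _ E3) (block_carryE _ E0) (block_carryE _ E1) (block_carryE _ E2).
by rewrite E0 E1 E2 E3; do 16?case: i => [|i] //.
Qed.

(** With at most 16 bits both sides have period 16, so agreement on the first 16 rows suffices. *)
Lemma next_pattern_row b p rb : size rb < 16 -> periodic p =1 flip_row rb ->
  periodic (next_pattern b p) =1 flip_row (b :: rb).
Proof.
move=> lt16 ep i; rewrite -(@flip_row_modn (b :: rb) i) //= -(eq_next_row b ep).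
by rewrite -periodic_next_pattern ?ltn_mod // /periodic modn_mod.
Qed.

Lemma periodic_zero : periodic (Quad h0 h0 h0 h0) =1 flip_row [::].
Proof.
move=> i /=; have : i %% 16 < 16 by rewrite ltn_mod.
by move: (i %% 16); do 16?case=> //.
Qed.

(** * Pruned search *)

(* The children of a node carry the flip patterns obtained by appending the bit 0,
   respectively 1. *)
Inductive ptree := PLeaf | PNode of quad hex & ptree & quad hex & ptree.

(** Flip patterns depend on the new bits alone, so one tree of them serves every node of the
    search. *)
Fixpoint patterns (k : nat) (p : quad hex) : ptree :=
  if k is k'.+1 then
    let p0 := next_pattern false p in let p1 := next_pattern true p in
    PNode p0 (patterns k' p0) p1 (patterns k' p1)
  else PLeaf.

Fixpoint path_sum (tabs : seq (quad (hex -> hex))) (s : hex) (pt : ptree) (bs : seq bool) : hex :=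
  match tabs, pt, bs with
  | w :: tabs', PNode p0 pt0 p1 pt1, b :: bs' =>
      if b then path_sum tabs' (table_add w p1 s) pt1 bs'
      else path_sum tabs' (table_add w p0 s) pt0 bs'
  | _, _, _ => s
  end.

Fixpoint row_hits (rb bs : seq bool) (B : seq (seq (option bool))) : nat :=
  match bs, B with
  | b :: bs', D :: B' => hits (flip_row (b :: rb)) D + row_hits (b :: rb) bs' B'
  | _, _ => 0
  end.

Lemma hval_path_sum B s p rb bs :
  periodic p =1 flip_row rb -> size rb + size bs <= 16 ->
  hval (path_sum (map table B) s (patterns (size bs) p) bs) = (hval s + row_hits rb bs B) %% 16.
Proof.
elim: B s p rb bs => [|D B IH] s p rb [|b bs] ep le16; rewrite /= ?addn0 ?hval_mod //.
have ltrb : size rb < 16 by apply: leq_trans le16; rewrite /= addnS ltnS leq_addr.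
have eb := next_pattern_row b ltrb ep.
have le16' : size (b :: rb) + size bs <= 16 by rewrite /= addSnnS.
case: b eb le16' {le16} => eb le16; rewrite (IH _ _ _ _ eb le16) hval_table_add modnDml addnA;
  by rewrite (eq_hits _ eb).
Qed.

Inductive trie := Fail | Done | Branch of trie & trie.

Definition branch (l r : trie) : trie :=
  match l, r with Fail, Fail => Fail | _, _ => Branch l r end.

Fixpoint words (t : trie) : seq (seq bool) :=
  match t with
  | Fail => [::]
  | Done => [:: [::]]
  | Branch l r => map (cons false) (words l) ++ map (cons true) (words r)
  end.

Lemma words_branch l r : words (branch l r) = words (Branch l r).
Proof. by case: l; case: r. Qed.

(** Candidates are kept in a trie so that words with a common prefix share its partial sum. *)
Fixpoint walk (tabs : seq (quad (hex -> hex))) (s : hex) (pt : ptree) (t : trie) {struct t} :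
    trie :=
  match t with
  | Fail => Fail
  | Done => if s is h0 then Done else Fail
  | Branch l r =>
      match tabs, pt with
      | w :: tabs', PNode p0 pt0 p1 pt1 =>
          branch (walk tabs' (table_add w p0 s) pt0 l) (walk tabs' (table_add w p1 s) pt1 r)
      | _, _ => Fail
      end
  end.

Lemma words_walk tabs s p t k :
  all (fun bs => size bs == k) (words t) -> size tabs = k ->
  words (walk tabs s (patterns k p) t) =
  [seq bs <- words t | is_h0 (path_sum tabs s (patterns k p) bs)].
Proof.
elim: t tabs s p k => [||l IHl r IHr] tabs s p k //=.
  by rewrite andbT => /eqP <-; case: tabs => // _; case: s.
rewrite all_cat !all_map => /andP[al ar].
case: tabs k al ar => [|w tabs] [|k] //= al ar => [_|[sz]].
  (* Words of a [Branch] are nonempty, so there are none of length 0. *)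
  suff [-> ->] : words l = [::] /\ words r = [::] by [].
  by split; [case: (words l) al | case: (words r) ar].
rewrite words_branch /= filter_cat !filter_map IHl ?IHr //.
Qed.

Fixpoint bit_words (k : nat) : seq (seq bool) :=
  if k is k'.+1 then map (cons false) (bit_words k') ++ map (cons true) (bit_words k')
  else [:: [::]].

Lemma size_bit_words k bs : bs \in bit_words k -> size bs = k.
Proof.
elim: k bs => [|k IH] bs /=; first by rewrite inE => /eqP->.
by rewrite mem_cat => /orP[] /mapP[bs' /IH <- ->].
Qed.

(* [solve_trie ls x] is the trie of the words [bs] for which the sum over F_2 of [x]
   and of the [ls_i] with [bs_i = 1] vanishes; tabulating over [x] shares subtries. *)
Fixpoint solve_trie (ls : seq hex) : hex -> trie :=
  if ls is l :: ls' then
    let v := solve_trie ls' in memo (fun x => branch (v x) (v (hxor l x)))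
  else memo (fun x => if x is h0 then Done else Fail).

Fixpoint combine (ls : seq hex) (bs : seq bool) (x : hex) : hex :=
  match ls, bs with
  | l :: ls', b :: bs' => combine ls' bs' (if b then hxor l x else x)
  | _, _ => x
  end.

Lemma words_solve_trie ls x :
  words (solve_trie ls x) = [seq bs <- bit_words (size ls) | is_h0 (combine ls bs x)].
Proof.
elim: ls x => [|l ls IH] x; first by case: x.
by rewrite -[solve_trie _]/(memo _) memoE words_branch /= filter_cat !filter_map !IH.
Qed.

(** Each entry contributes to the parity an affine function over F_2 of its flip; the count without
    flips is the constant term. *)
Lemma odd_hits f g h D : h =1 (fun i => f i (+) g i) ->
  odd (hits h D) (+) odd (hits (fun=> false) D) = odd (hits f D) (+) odd (hits g D).
Proof.
elim: D f g h => //= o D IH f g h e.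
rewrite !oddD addbACA (IH (fun i => f i.+1) (fun i => g i.+1)) // [RHS]addbACA.
congr (_ (+) _); case: o => // t; rewrite !oddb e addbF.
by case: t (f 0) (g 0) => [] [] [].
Qed.

Definition xor_word (u v : seq bool) : seq bool := [seq x.1 (+) x.2 | x <- zip u v].

Lemma flip_row_xor_word u v : size u = size v ->
  flip_row (xor_word u v) =1 (fun i => flip_row u i (+) flip_row v i).
Proof.
elim: u v => [|a u IH] [|b v] //= [/IH e]; elim=> //= i ->.
by rewrite e addbACA.
Qed.

Lemma flip_row_nseq k : flip_row (nseq k false) =1 (fun=> false).
Proof. by elim: k => //= k IH; elim=> //= i ->; rewrite IH. Qed.

Lemma odd_row_hits ru rv u v B : size ru = size rv -> size u = size v ->
  odd (row_hits (xor_word ru rv) (xor_word u v) B) (+)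
    odd (row_hits (nseq (size ru) false) (nseq (size u) false) B) =
  odd (row_hits ru u B) (+) odd (row_hits rv v B).
Proof.
elim: B ru rv u v => [|D B IH] ru rv [|a u] [|b v] //= eqr [eqs].
have eqr' : size (a :: ru) = size (b :: rv) by rewrite /= eqr.
rewrite !oddD addbACA (IH (a :: ru) (b :: rv) u v eqr' eqs) [RHS]addbACA; congr (_ (+) _).
rewrite [X in _ (+) odd X = _](eq_hits _ (flip_row_nseq (size ru).+1)).
by apply: odd_hits; apply: (@flip_row_xor_word (a :: ru) (b :: rv)).
Qed.

(** * Extensions of a lift by at most 16 terms *)

(* An antidiagonal is listed from the first row down, so that its head is the term
   of the sequence that completed it. *)
Fixpoint next_diag (x : hex) (A : seq hex) : seq hex :=
  x :: if A is v :: A' then next_diag (add8 x v) A' else [::].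

Fixpoint diags (A w : seq hex) : seq (seq hex) :=
  if w is x :: w' then let D := next_diag x A in D :: diags D w' else [::].

Definition last_diag (A w : seq hex) : seq hex := foldl (fun A x => next_diag x A) A w.

Definition flip (b : bool) (x : hex) : hex := if b then add8 h4 x else x.

Definition lift (w : seq hex) (bs : seq bool) : seq hex := [seq flip x.2 x.1 | x <- zip w bs].

Definition top_bit := Eval compute in
  tabulate (fun a => tabulate (fun x =>
    if hval x %% 4 == hval a then Some (3 < hval x %% 8) else None)).

Fixpoint flips (f : nat -> bool) (A : seq hex) : seq hex :=
  if A is v :: A' then flip (f 0) v :: flips (fun i => f i.+1) A' else [::].

Lemma eq_flips f g A : f =1 g -> flips f A = flips g A.
Proof.
elim: A f g => //= v A IH f g efg; rewrite efg; congr (_ :: _).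
by apply: IH => i; rewrite efg.
Qed.

Lemma flips_false A : flips (fun=> false) A = A.
Proof. by elim: A => //= v A ->. Qed.

Lemma add8_flip b c x y : add8 (flip b x) (flip c y) = flip (b (+) c) (add8 x y).
Proof. by case: x; case: y; case: b; case: c. Qed.

(** [next_row] recurses from the last row and [next_diag] from the first; this reconciles the
    two. *)
Lemma next_row_behead b f i : next_row b f i.+1 = next_row (b (+) f 0) (fun i => f i.+1) i.
Proof. by elim: i => //= i <-. Qed.

(** As 4 + 4 = 0 modulo 8, top-bit flips propagate by the Steinhaus rule over F_2, independently of
    the entries. *)
Lemma next_diag_flips b f x A :
  next_diag (flip b x) (flips f A) = flips (next_row b f) (next_diag x A).
Proof.
elim: A b f x => //= v A IH b f x; rewrite add8_flip IH; congr (_ :: _).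
by apply: eq_flips => i; rewrite -next_row_behead.
Qed.

Lemma top_bit_flip a b x : hval a < 4 ->
  eq8 (add8 h4 a) (flip b x) = (if top_bit a x is Some t then t (+) b else false).
Proof. by case: a; case: x; case: b. Qed.

Lemma count_flips a f D : hval a < 4 ->
  count (eq8 (add8 h4 a)) (flips f D) = hits f (map (top_bit a) D).
Proof.
by move=> lta; elim: D f => //= v D IH f; rewrite IH (top_bit_flip _ _ lta); case: top_bit.
Qed.

Lemma count_lift a rb bs A cs : hval a < 4 -> size bs = size cs ->
  count (eq8 (add8 h4 a)) (flatten (diags (flips (flip_row rb) A) (lift cs bs))) =
  row_hits rb bs [seq map (top_bit a) D | D <- diags A cs].
Proof.
move=> lta; elim: cs bs rb A => [|c cs IH] [|b bs] rb A //= [e].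
by rewrite count_cat next_diag_flips (count_flips _ _ lta) -(IH _ (b :: rb)).
Qed.

Definition equidistributed (m : nat) (B : seq (seq hex)) : bool :=
  let s := flatten B in
  all (fun x => count (eq8 x) s == m) octits.

Definition low_bit (x : hex) : bool := head false (hbits x).

Lemma low_bitE x : low_bit x = odd (hval x).
Proof. by case: x. Qed.

Definition parities (tabs : seq (seq (quad (hex -> hex)))) (s : hex) (pt : ptree) (bs : seq bool) :
    hex :=
  if [seq low_bit (path_sum w s pt bs) | w <- tabs] is [:: a; b; c; d]
  then hex_of_bits a b c d else h0.

Definition unit_word (k i : nat) : seq bool := nseq i false ++ true :: nseq (k - i.+1) false.

(* For a class a, the parity of the number of entries a + 4 is an affine function of
   the new bits [bs]: [ls] and [x0] describe these four functions and prune first;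
   the counts modulo 16, started at [- m], prune next; the survivors are tested. *)
Definition extensions (pt : ptree) (m : nat) (A cs : seq hex) : seq (seq hex) :=
  let B := diags A cs in
  let tabs := [seq [seq table (map (top_bit a) D) | D <- B] | a <- [:: h0; h1; h2; h3]] in
  let s := hex_of_nat (16 - m %% 16) in
  let k := size cs in
  let x0 := parities tabs s pt (nseq k false) in
  let ls := mkseq (fun i => hxor x0 (parities tabs s pt (unit_word k i))) k in
  let t := foldl (fun t w => walk w s pt t) (solve_trie ls x0) tabs in
  [seq w <- map (lift cs) (words t) | equidistributed m (diags A w)].

Lemma hxor_bits a b c d a' b' c' d' :
  hxor (hex_of_bits a b c d) (hex_of_bits a' b' c' d') =
  hex_of_bits (a (+) a') (b (+) b') (c (+) c') (d (+) d').
Proof. by case: a b c d a' b' c' d' => [] [] [] [] [] [] [] []. Qed.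

(** After the prefix [p], the accumulator holds [F] at [p] padded with zeros. Setting the next bit
    adds a unit word, which changes an affine [F] by the corresponding element of [ls]. *)
Lemma combine_affine k (F : seq bool -> hex) (ls : seq hex) p bs :
  (forall u v, size u = k -> size v = k ->
     F (xor_word u v) = hxor (hxor (F (nseq k false)) (F u)) (F v)) ->
  ls = mkseq (fun i => hxor (F (nseq k false)) (F (unit_word k i))) k ->
  size p + size bs = k ->
  combine (drop (size p) ls) bs (F (p ++ nseq (size bs) false)) = F (p ++ bs).
Proof.
move=> affF els; have sz_ls : size ls = k by rewrite els size_mkseq.
elim: bs p => [|b bs IH] p /= ek; first by rewrite cats0; case: (drop _ _).
have ltpk : size p < k by rewrite -ek addnS ltnS leq_addr.
rewrite (drop_nth h0) ?sz_ls //=.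
have := IH (rcons p b); rewrite size_rcons !cat_rcons addSnnS => /(_ ek) <-; congr (combine _ _ _).
case: b => //; rewrite els nth_mkseq // -affF; last 2 first.
- by rewrite /unit_word size_cat /= !size_nseq -addSnnS subnKC.
- by rewrite size_cat /= size_nseq.
(* The unit word at position [size p], added to [p] padded with zeros, gives [p] followed by 1 and
   zeros. *)
congr F; rewrite /unit_word -ek addnS subSS addKn.
elim: p {IH ek ltpk} => [|c p ep] /=; last by rewrite -ep.
by congr cons; elim: (size bs) => //= n ->.
Qed.

Lemma words_walks tabs s p t k :
  all (fun bs => size bs == k) (words t) -> all (fun w => size w == k) tabs ->
  words (foldl (fun t w => walk w s (patterns k p) t) t tabs) =
  [seq bs <- words t | all (fun w => is_h0 (path_sum w s (patterns k p) bs)) tabs].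
Proof.
elim: tabs t => [|w tabs IH] t /= sz_t; first by rewrite filter_predT.
case/andP=> /eqP sz_w sz_tabs; rewrite IH ?words_walk // -?filter_predI.
  by apply: eq_filter => bs; rewrite /= andbC.
by apply/allP => bs; rewrite mem_filter => /andP[_]; apply: (allP sz_t).
Qed.

Lemma size_diags A cs : size (diags A cs) = size cs.
Proof. by elim: cs A => //= c cs IH A; rewrite IH. Qed.

(** Both prunings test necessary conditions for equidistribution, so they lose no extension that
    passes the final test. *)
Lemma extensionsE m A cs : size cs <= 16 ->
  extensions (patterns (size cs) (Quad h0 h0 h0 h0)) m A cs =
  [seq w <- map (lift cs) (bit_words (size cs)) | equidistributed m (diags A w)].
Proof.
move=> le16; rewrite /extensions; set tabs := map _ [:: _; _; _; _].
set s := hex_of_nat _; set pt := patterns _ _; set ls := mkseq _ _; set k := size cs.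
pose B a := [seq map (top_bit a) D | D <- diags A cs].
have sumE a bs : size bs = k ->
    hval (path_sum (map table (B a)) s pt bs) = (hval s + row_hits [::] bs (B a)) %% 16.
  by move=> sz; rewrite /pt -/k -sz (hval_path_sum _ _ periodic_zero) // sz.
have tabsE : tabs = [seq map table (B a) | a <- [:: h0; h1; h2; h3]].
  by apply: eq_map => a; rewrite -map_comp.
pose F := parities tabs s pt.
have affF u v : size u = k -> size v = k ->
    F (xor_word u v) = hxor (hxor (F (nseq k false)) (F u)) (F v).
  move=> szu szv; rewrite /F /parities tabsE /= !hxor_bits !low_bitE.
  have szuv : size (xor_word u v) = k by rewrite size_map size_zip szu szv minnn.
  rewrite !sumE ?size_nseq //.
  have aff a : odd ((hval s + row_hits [::] (xor_word u v) (B a)) %% 16) =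
     odd ((hval s + row_hits [::] (nseq k false) (B a)) %% 16) (+)
     odd ((hval s + row_hits [::] u (B a)) %% 16) (+) odd ((hval s + row_hits [::] v (B a)) %% 16).
    rewrite !odd_mod // !oddD.
    have := @odd_row_hits [::] [::] u v (B a) erefl; rewrite szu szv => /(_ erefl) /= e.
    rewrite -(addbK (odd (row_hits [::] (nseq k false) (B a)))
      (odd (row_hits [::] (xor_word u v) _))) e.
    by case: (odd _) (odd _) (odd _) (odd _) => [] [] [] [].
  by rewrite -!aff.
have sz_ls : size ls = k by rewrite size_mkseq.
have sz_t x : all (fun bs => size bs == k) (words (solve_trie ls x)).
  by apply/allP => bs; rewrite words_solve_trie mem_filter sz_ls => /andP[_ /size_bit_words->].
have sz_tabs : all (fun w => size w == k) tabs.
  by rewrite tabsE /= !size_map !size_diags !eqxx.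
rewrite words_walks // words_solve_trie sz_ls !filter_map -!filter_predI.
congr map; apply: eq_in_filter => bs /size_bit_words sz.
pose ok := equidistributed m (diags A (lift cs bs)).
rewrite -[LHS]/((ok && all (fun w => is_h0 (path_sum w s pt bs)) tabs) &&
  is_h0 (combine ls bs (F (nseq k false)))) -[RHS]/ok -andbA; apply: andb_idr => eqd.
have zero a : a \in [:: 0; 1; 2; 3] -> is_h0 (path_sum (map table (B (nth h0 hexes a))) s pt bs).
  move=> a4; rewrite is_h0E sumE //.
  (* An equidistributed block has exactly [m] entries of each value, and the counter starts at [- m]
     modulo 16. *)
  have -> : row_hits [::] bs (B (nth h0 hexes a)) = m.
    rewrite -count_lift //; last by move: a4; rewrite !inE => /or4P[] /eqP->.
    rewrite (eq_flips _ (g := fun=> false)) // flips_false; apply/eqP.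
    by case/and5P: eqd a4 => _ _ _ _ /and5P[? ? ? ? _]; rewrite !inE => /or4P[] /eqP->.
  rewrite hval_hex_of_nat modnDml -modnDmr subnK ?modnn //.
  by rewrite ltnW // ltn_mod.
have {}zero : all (fun w => is_h0 (path_sum w s pt bs)) tabs.
  by rewrite tabsE /= (zero 0) // (zero 1) // (zero 2) // (zero 3).
(* The affine test reads the low bits of these same vanishing sums. *)
rewrite zero andTb (_ : combine _ _ _ = F bs).
  move: zero; rewrite /F /parities tabsE /= !low_bitE !is_h0E.
  by case/and5P=> /eqP-> /eqP-> /eqP-> /eqP->.
rewrite -[bs in RHS]cat0s -(combine_affine affF (erefl ls)) //=.
by rewrite drop0 sz.
Qed.

(** * Chains of extensions *)

Definition segment (u w : seq hex) (n k : nat) : seq hex :=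
  mkseq (fun i => let j := n + i in
    if j < size u then nth h0 u j else nth h0 w ((j - size u) %% size w)) k.

(** The new antidiagonals have lengths n + 1, ..., n + [size cs]; each residue must receive one
    eighth of their entries. *)
Definition extend_all (pt : ptree) (cs : seq hex) (n : nat) (L : seq (seq hex)) : seq (seq hex) :=
  let m := sumn (iota n.+1 (size cs)) %/ 8 in
  flatten [seq map (cat T) (extensions pt m (last_diag [::] T) cs) | T <- L].

Definition all_patterns (k : nat) : ptree := patterns k (Quad h0 h0 h0 h0).

Fixpoint counts_from (q : nat) (pt : ptree) (u w : seq hex) (n : nat) (L : seq (seq hex)) :
    seq nat :=
  if q is q'.+1 then
    size L :: counts_from q' pt u w (n + 16) (extend_all pt (segment u w n 16) n L)
  else [::].

Definition lift_counts (q : nat) (u w : seq hex) (k : nat) : seq nat :=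
  counts_from q (all_patterns 16) u w k
    (extend_all (all_patterns k) (segment u w 0 k) 0 [:: [::]]).

(** * Steinhaus triangles *)

Definition toZ (x : hex) : 'Z_8 := inZp (hval x).

Lemma toZ_add8 x y : toZ (add8 x y) = (toZ x + toZ y)%R.
Proof. by apply: val_inj; case: x; case: y. Qed.

Lemma eq8E x y : eq8 x y = (toZ x == toZ y).
Proof. by case: x; case: y. Qed.

Definition antidiagonal (x : nat -> 'Z_8) (d : nat) : seq 'Z_8 :=
  mkseq (fun i => steinhaus x i (d.-1 - i)) d.

Lemma mkseqSl T (f : nat -> T) n : mkseq f n.+1 = f 0 :: mkseq (fun i => f i.+1) n.
Proof. by rewrite /mkseq /= -[1]addn0 iotaDl -map_comp. Qed.

Lemma map_next_diag c A (f g : nat -> 'Z_8) :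
  map toZ A = mkseq f (size A) -> g 0 = toZ c ->
  (forall i, i < size A -> g i.+1 = (g i + f i)%R) ->
  map toZ (next_diag c A) = mkseq g (size A).+1.
Proof.
elim: A c f g => [|v A IH] c f g eA g0 gS; first by rewrite /= /mkseq /= g0.
move: eA; rewrite (mkseqSl f) /= => /eqP; rewrite eqseq_cons => /andP[/eqP ev /eqP eA].
rewrite (mkseqSl g) g0; congr (_ :: _).
apply: (IH _ (fun i => f i.+1) (fun i => g i.+1)) => [||i lti]; [exact: eA | | exact: gS].
by rewrite gS // g0 toZ_add8 ev.
Qed.

Lemma next_diag_antidiagonal x c A d :
  map toZ A = antidiagonal x d -> toZ c = x d ->
  map toZ (next_diag c A) = antidiagonal x d.+1.
Proof.
move=> eA ec; have szA : size A = d by rewrite -(size_map toZ) eA size_mkseq.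
rewrite -{}szA in eA ec *; apply: (map_next_diag eA) => [|i lti] /=; first by rewrite subn0.
by rewrite subnSK // GRing.addrC -subn1 -subnDA add1n.
Qed.

Lemma map_diags x w A d :
  map toZ A = antidiagonal x d -> (forall i, i < size w -> toZ (nth h0 w i) = x (d + i)) ->
  map (map toZ) (diags A w) = [seq antidiagonal x d'.+1 | d' <- iota d (size w)].
Proof.
elim: w A d => //= c w IH A d eA ew.
have eD := next_diag_antidiagonal eA (etrans (ew 0 isT) (congr1 x (addn0 d))).
by rewrite eD (IH _ _ eD) // => i lti; rewrite (ew i.+1) // addSnnS.
Qed.

Definition entries (s : seq 'Z_8) : seq 'Z_8 :=
  flatten [seq antidiagonal (nth 0%R s) d.+1 | d <- iota 0 (size s)].

Lemma entries_toZ w : entries (map toZ w) = map toZ (flatten (diags [::] w)).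
Proof.
rewrite map_flatten (@map_diags (nth 0%R (map toZ w)) _ _ 0) //.
  by rewrite /entries size_map.
by move=> i lti; rewrite (nth_map h0).
Qed.

Lemma multiplicityE (s : seq 'Z_8) a : multiplicity s a = count_mem a (entries s).
Proof.
rewrite /multiplicity /entries count_flatten -map_comp sumnE big_map.
set n := size s; set x := nth 0%R s.
rewrite -sum1_card (eq_bigl (fun p : 'I_n * 'I_n =>
  (p.1 + p.2 < n) && (steinhaus x p.1 p.2 == a))); last by move=> p; rewrite inE.
rewrite big_mkcond -(pair_bigA _ (fun i j : 'I_n =>
  if (i + j < n) && (steinhaus x i j == a) then 1 else 0)).
rewrite -(big_mkord xpredT (fun i => \sum_(j < n)
  if (i + j < n) && (steinhaus x i j == a) then 1 else 0)).
(* The column j is replaced by the antidiagonal d = i + j, so that exchanging the sums groups the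
   entries by antidiagonal. *)
transitivity (\sum_(0 <= i < n) \sum_(0 <= d < n | i <= d) (steinhaus x i (d - i) == a)).
  apply: eq_bigr => i _.
  rewrite -(big_mkord xpredT (fun j => if (i + j < n) && (steinhaus x i j == a) then 1 else 0)).
  have -> : \sum_(0 <= d < n | i <= d) (steinhaus x i (d - i) == a) =
      \sum_(0 + i <= d < n) (steinhaus x i (d - i) == a).
    by rewrite add0n [RHS](big_nat_widenl _ 0).
  rewrite big_addn [RHS](big_nat_widen _ _ n) ?leq_subr // [RHS]big_mkcond /=.
  apply: eq_bigr => j _; rewrite addnK ltn_subRL.
  by case: (_ < _) => //=; case: (_ == _).
rewrite (exchange_big_dep_nat xpredT) // /index_iota subn0 big_seq [RHS]big_seq.
apply: eq_bigr => d; rewrite mem_iota add0n => ltd.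
rewrite -[RHS]/(count_mem a (antidiagonal x d.+1)) /antidiagonal /mkseq count_map -sum1_count.
rewrite [RHS]big_mkcond.
have -> : iota 0 d.+1 = index_iota 0 d.+1 by rewrite /index_iota subn0.
rewrite (big_nat_widen _ _ n) // /index_iota subn0.
by apply: eq_big => i //= _; case: (_ == _).
Qed.

(** The triangular number n(n + 1)/2, the size of the triangle. *)
Definition weight (n : nat) : nat := sumn (iota 1 n).

Lemma size_entries s : size (entries s) = weight (size s).
Proof.
rewrite size_flatten /shape -map_comp (eq_map (g := S)) => [|d]; last first.
  by rewrite /= size_map size_iota.
by rewrite /weight (iotaDl 1 0); congr sumn; apply: eq_map.
Qed.

Lemma sum_count_mem_finType (T : finType) (s : seq T) : \sum_(a : T) count_mem a s = size s.
Proof.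
elim: s => [|x s IH] /=; first by rewrite big1.
by rewrite big_split /= IH (bigD1 x) //= eqxx big1 // => y /negPf; rewrite eq_sym => ->.
Qed.

(** The eight multiplicities add up to the size of the triangle, so they agree exactly when each is
    one eighth of it. *)
Lemma balancedE (s : seq 'Z_8) :
  balanced s = [forall a : 'Z_8, 8 * count_mem a (entries s) == weight (size s)].
Proof.
apply/forallP/forallP => [eqs a|eqs a].
  rewrite -size_entries -sum_count_mem_finType (eq_bigr (fun=> count_mem a (entries s))).
    by rewrite sum_nat_const card_ord.
  by move=> b _; rewrite -!multiplicityE (eqP (forallP (eqs a) b)).
apply/forallP => b; rewrite !multiplicityE.
by rewrite -(eqn_pmul2l (m := 8)) // (eqP (eqs a)) (eqP (eqs b)).
Qed.

Definition balanced_word (w : seq hex) : bool :=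
  all (fun x => 8 * count (eq8 x) (flatten (diags [::] w)) == weight (size w)) octits.

Lemma toZ_nth (a : 'Z_8) : toZ (nth h0 octits a) = a.
Proof. by apply: val_inj; case: a => [[|[|[|[|[|[|[|[|a]]]]]]]] lta]. Qed.

Lemma balanced_wordE w : balanced (map toZ w) = balanced_word w.
Proof.
have countE x : count_mem (toZ x) (entries (map toZ w)) = count (eq8 x) (flatten (diags [::] w)).
  by rewrite entries_toZ count_map; apply: eq_count => y /=; rewrite eq8E eq_sym.
rewrite balancedE size_map; apply/forallP/idP => [eqs | /(all_nthP h0) eqs a].
  by apply/(all_nthP h0) => i _; rewrite -countE.
by rewrite -(toZ_nth a) countE; apply: eqs; apply: (ltn_ord a).
Qed.

Lemma diags_cat A T w : diags A (T ++ w) = diags A T ++ diags (last_diag A T) w.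
Proof. by elim: T A => //= x T IH A; rewrite IH. Qed.

Lemma weightD n k : weight (n + k) = weight n + sumn (iota n.+1 k).
Proof. by rewrite /weight iotaD sumn_cat add1n. Qed.

(** The triangle of [T] and the new antidiagonals partition the triangle of [T ++ w], so the counts
    subtract. *)
Lemma balanced_word_cat T w m :
  balanced_word T -> sumn (iota (size T).+1 (size w)) = 8 * m ->
  balanced_word (T ++ w) = equidistributed m (diags (last_diag [::] T) w).
Proof.
move=> /(all_nthP h0) balT em; apply/(all_nthP h0)/(all_nthP h0) => eqs i lti.
  have := eqs i lti; rewrite diags_cat flatten_cat count_cat size_cat weightD em mulnDr.
  by rewrite (eqP (balT i lti)) eqn_add2l eqn_pmul2l.
rewrite diags_cat flatten_cat count_cat size_cat weightD em mulnDr.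
by rewrite (eqP (balT i lti)) eqn_add2l eqn_pmul2l // eqs.
Qed.

(** * Strong balance along chains of lifts *)

Definition strong (w : seq hex) : bool := strongly_balanced (map toZ w).

Lemma strongP w :
  reflect (forall t, 16 * t <= size w -> balanced_word (take (size w - 16 * t) w)) (strong w).
Proof.
apply: (iffP forallP) => [bal t let_ | bal t].
  have ltt : t < (size (map toZ w)).+1.
    by rewrite size_map ltnS (leq_trans _ let_) // leq_pmull.
  have /implyP/= := bal (Ordinal ltt); rewrite size_map => /(_ let_).
  by rewrite -map_take balanced_wordE.
by case: t => t ltt /=; apply/implyP; rewrite size_map -map_take balanced_wordE; apply: bal.
Qed.

Lemma strong_small w : size w < 16 -> strong w = balanced_word w.
Proof.
move=> lt16; apply/strongP/idP => [/(_ 0)|bal [|t]]; rewrite ?muln0 ?subn0 ?take_size //.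
  exact.
by rewrite mulnS => le16; have := leq_trans lt16 (leq_trans (leq_addr _ _) le16); rewrite ltnn.
Qed.

Lemma strong_balanced w : strong w -> balanced_word w.
Proof. by move=> /strongP/(_ 0); rewrite muln0 subn0 take_size; apply. Qed.

(** Cutting 16(t + 1) terms off [T ++ w] cuts 16t terms off [T]; only the uncut word gives a new
    condition. *)
Lemma strong_cat T w : size w = 16 -> strong (T ++ w) = strong T && balanced_word (T ++ w).
Proof.
move=> sz16; apply/idP/andP => [st | [/strongP stT bal]].
  split; last exact: strong_balanced.
  apply/strongP => t le_t; have /strongP/(_ t.+1) := st.
  rewrite size_cat sz16 mulnS (addnC (size T)) leq_add2l subnDl => /(_ le_t).
  by rewrite takel_cat // leq_subr.
apply/strongP => -[|t]; first by rewrite muln0 subn0 take_size.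
rewrite size_cat sz16 mulnS (addnC (size T)) leq_add2l subnDl => le_t.
by rewrite takel_cat ?leq_subr ?stT.
Qed.

Definition lifts (cs : seq hex) : seq (seq hex) := map (lift cs) (bit_words (size cs)).

Lemma lifts_cons c cs :
  lifts (c :: cs) = map (cons c) (lifts cs) ++ map (cons (flip true c)) (lifts cs).
Proof. by rewrite /lifts /= map_cat -!map_comp. Qed.

Lemma lifts_cat cs cs' : lifts (cs ++ cs') = [seq T ++ w | T <- lifts cs, w <- lifts cs'].
Proof.
elim: cs => [|c cs IH]; first by rewrite /= cats0 map_id.
rewrite cat_cons !lifts_cons IH map_cat flatten_cat !map_flatten -!map_comp.
by congr (flatten _ ++ flatten _); apply: eq_map => T /=; rewrite -map_comp.
Qed.

Lemma size_lifts cs w : w \in lifts cs -> size w = size cs.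
Proof. by case/mapP=> bs /size_bit_words sz ->; rewrite size_map size_zip sz minnn. Qed.

Definition strong_lifts (cs : seq hex) : seq (seq hex) := [seq T <- lifts cs | strong T].

Lemma extend_allE cs n k (L : seq (seq hex)) :
  size cs = k -> k <= 16 -> 8 %| sumn (iota n.+1 k) ->
  (forall T, T \in L -> size T = n /\ balanced_word T) ->
  extend_all (all_patterns k) cs n L =
  flatten [seq [seq T ++ w | w <- lifts cs & balanced_word (T ++ w)] | T <- L].
Proof.
move=> szc le16 div8 okL; rewrite /extend_all; congr flatten.
apply/eq_in_map => T /okL[szT balT]; congr (map _ _).
rewrite /all_patterns -szc extensionsE; last by rewrite szc.
apply: eq_in_filter => w /size_lifts szw; apply/esym/balanced_word_cat => //.
by rewrite szT szw szc mulnC divnK.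
Qed.

Lemma strong_lifts_cat cs cs' : size cs' = 16 ->
  strong_lifts (cs ++ cs') =
  flatten [seq [seq T ++ w | w <- lifts cs' & balanced_word (T ++ w)] | T <- strong_lifts cs].
Proof.
move=> sz16; rewrite /strong_lifts lifts_cat; elim: (lifts cs) => //= T L IH.
rewrite filter_cat IH filter_map.
have -> : [seq w <- lifts cs' | preim (cat T) strong w] =
    if strong T then [seq w <- lifts cs' | balanced_word (T ++ w)] else [::].
  case: ifP => sT; [apply: eq_in_filter | rewrite -(filter_pred0 (lifts cs')); apply: eq_in_filter];
    by move=> w /size_lifts szw; rewrite /= strong_cat ?szw ?sz16 ?sT.
by case: (strong T).
Qed.

Lemma strong_lifts_small cs : size cs <= 16 ->
  strong_lifts cs = [seq w <- lifts cs | balanced_word w].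
Proof.
move=> le16; apply: eq_in_filter => w /size_lifts szw.
move: le16; rewrite leq_eqVlt -szw => /orP[/eqP sz16|]; last exact: strong_small.
by rewrite -[w in LHS]cat0s strong_cat // strong_small.
Qed.

Lemma sumn_iotaS n k : sumn (iota n.+1 k) = sumn (iota n k) + k.
Proof. by elim: k n => //= k IH n; rewrite IH addSn addnA addnS. Qed.

(** The sum 1 + ... + 16 is 136 = 8 * 17, and raising the start by one adds 16. *)
Lemma dvdn_weight16 n : 8 %| sumn (iota n.+1 16).
Proof. by elim: n => // n IH; rewrite sumn_iotaS dvdn_addl. Qed.

Lemma segmentD u w n k : segment u w 0 (n + k) = segment u w 0 n ++ segment u w n k.
Proof.
rewrite /segment /mkseq iotaD map_cat add0n; congr (_ ++ _).
by rewrite -[in LHS](addn0 n) iotaDl -map_comp.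
Qed.

Lemma counts_fromE q u w n :
  counts_from q (all_patterns 16) u w n (strong_lifts (segment u w 0 n)) =
  mkseq (fun i => size (strong_lifts (segment u w 0 (n + 16 * i)))) q.
Proof.
elim: q n => // q IH n; rewrite mkseqSl muln0 addn0 [LHS]/=; congr (_ :: _).
rewrite (@extend_allE _ _ 16) ?size_mkseq ?dvdn_weight16 //; last first.
  move=> T; rewrite mem_filter => /andP[sT /size_lifts]; rewrite size_mkseq.
  by split; last exact: strong_balanced.
rewrite -strong_lifts_cat ?size_mkseq // -segmentD.
by rewrite IH; apply: eq_mkseq => i; rewrite mulnS addnA.
Qed.

Lemma lift_countsE q u w k : k <= 16 -> 8 %| sumn (iota 1 k) ->
  lift_counts q u w k = mkseq (fun i => size (strong_lifts (segment u w 0 (k + 16 * i)))) q.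
Proof.
move=> le16 div8; rewrite /lift_counts (@extend_allE _ _ k) ?size_mkseq //; last first.
  by move=> T; rewrite inE => /eqP->.
by rewrite /= cats0 map_id -strong_lifts_small ?size_mkseq // counts_fromE.
Qed.

Lemma strong_lifts_nil_cat u w n i :
  strong_lifts (segment u w 0 n) = [::] -> strong_lifts (segment u w 0 (n + 16 * i)) = [::].
Proof.
move=> nil; elim: i => [|i IH]; first by rewrite addn0.
by rewrite mulnS addnCA addnC segmentD strong_lifts_cat ?size_mkseq // IH.
Qed.

(* The final 0 shows that no longer strongly balanced lift exists. *)
Definition has_counts (u w : seq hex) (k : nat) (c : seq nat) : Prop :=
  lift_counts (size c).+1 u w k = rcons c 0.

Lemma size_strong_lifts u w k c i : k <= 16 -> 8 %| sumn (iota 1 k) ->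
  has_counts u w k c ->
  size (strong_lifts (segment u w 0 (k + 16 * i))) = nth 0 c i.
Proof.
move=> le16 div8 eqc.
have nthE j : j <= size c -> nth 0 (rcons c 0) j = size (strong_lifts (segment u w 0 (k + 16 * j))).
  by move=> lej; rewrite -eqc lift_countsE // nth_mkseq.
have [ltic|leci] := ltnP i (size c); first by rewrite -nthE ?nth_rcons ?ltic // ltnW.
(* Past the end of [c], the lifts restrict to the level [size c], which the final 0 shows to be
   empty. *)
rewrite nth_default // -(subnKC leci) mulnDr addnA strong_lifts_nil_cat //.
by apply/size0nil; rewrite -nthE // nth_rcons ltnn eqxx.
Qed.

Lemma strong_lifts_weight cs : ~~ (8 %| weight (size cs)) -> strong_lifts cs = [::].
Proof.
move=> ndiv; rewrite /strong_lifts -(filter_pred0 (lifts cs)); apply: eq_in_filter => w szw.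
apply/negP => /strong_balanced/(all_nthP h0)/(_ 0 isT)/eqP bal.
by case/negP: ndiv; rewrite -(size_lifts szw) -bal dvdn_mulr.
Qed.

(** Modulo 8 the weight has period 16 in n, which leaves 16 residues to check. *)
Lemma dvdn_weight n : (8 %| weight n) = (n %% 16 == 0) || (n %% 16 == 15).
Proof.
have red q r : (8 %| weight (r + q * 16)) = (8 %| weight r).
  elim: q => [|q IH]; first by rewrite addn0.
  by rewrite mulSn addnCA addnC weightD dvdn_addl ?dvdn_weight16.
rewrite [in LHS](divn_eq n 16) addnC red.
have : n %% 16 < 16 by rewrite ltn_mod.
by move: (n %% 16); do 16?case=> //.
Qed.

(** * Lifts from Z/4 to Z/8 *)

Definition toZ4 (x : hex) : 'Z_4 := inZp (hval x).

Lemma Zquot_lifts cs (T : seq 'Z_8) :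
  (map (@Zquot 4) T == map toZ4 cs) = (T \in map (map toZ) (lifts cs)).
Proof.
elim: cs T => [|c cs IH] [|z T] //=.
- rewrite lifts_cons map_cat mem_cat -!(map_comp (map toZ)).
  by apply/esym/negbTE/negP => /orP[]/mapP[].
rewrite eqseq_cons IH lifts_cons map_cat mem_cat.
(* The fibre over the class of c consists of c and c + 4; all cases are checked. *)
have -> : (Zquot (m := 4) z == toZ4 c) = (z == toZ c) || (z == toZ (flip true c)).
  by case: z => [[|[|[|[|[|[|[|[|z]]]]]]]] ltz]; case: c.
have mem_cons x (L : seq (seq hex)) :
    (z :: T \in map (map toZ) (map (cons x) L)) = (z == toZ x) && (T \in map (map toZ) L).
  elim: L => [|w L IHL]; first by rewrite andbF.
  by rewrite /= !inE IHL eqseq_cons; case: (z == _).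
by rewrite !mem_cons andb_orl.
Qed.

Lemma uniq_lifts cs : uniq (map (map toZ) (lifts cs)).
Proof.
elim: cs => // c cs IH; rewrite lifts_cons map_cat cat_uniq.
have uniq_cons x : uniq (map (map toZ) (map (cons x) (lifts cs))).
  by rewrite -map_comp (map_comp (cons (toZ x)) (map toZ)) map_inj_uniq // => ? ? [].
rewrite !uniq_cons /= andbT; apply/hasPn => _ /mapP[_ /mapP[w _ ->] ->].
by apply/mapP => -[_ /mapP[w' _ ->] [/eqP]]; case: c {uniq_cons}.
Qed.

Lemma num_liftsE (S : nat -> 'Z_4) n cs : mkseq S n = map toZ4 cs ->
  num_lifts S n = size (strong_lifts cs).
Proof.
move=> eS; have szc : size cs = n by rewrite -(size_map toZ4) -eS size_mkseq.
have -> : num_lifts S n = #|[set T : n.-tuple 'Z_8 |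
    @strongly_balanced 8 T && (map (@Zquot 4) T == mkseq S n)]| by [].
rewrite cardE -(size_map val) -(size_map (map toZ) (strong_lifts cs)).
(* Both lists are duplicate-free, so equal membership gives equal size. *)
apply/perm_size/uniq_perm.
- by rewrite map_inj_uniq ?enum_uniq //; apply: val_inj.
- by apply: subseq_uniq (uniq_lifts cs); apply/map_subseq/filter_subseq.
move=> T; apply/mapP/mapP => [[T' ] | [w]].
  rewrite mem_enum inE eS Zquot_lifts => /andP[sT' /mapP[w wL eT] ->].
  by exists w; rewrite // mem_filter wL /strong -eT sT'.
rewrite mem_filter => /andP[sw wL] eT.
have szT : size T == n by rewrite eT size_map (size_lifts wL) szc.
exists (Tuple szT) => //; rewrite mem_enum inE eS Zquot_lifts /= eT.
by rewrite map_f // andbT.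
Qed.

Lemma mkseq_preperiodic (u w : seq hex) n : 0 < size w ->
  mkseq (preperiodic (map toZ4 u) (map toZ4 w)) n = map toZ4 (segment u w 0 n).
Proof.
move=> w_gt0; rewrite /segment /mkseq -map_comp; apply: eq_map => i /=.
by rewrite /preperiodic !size_map add0n; case: ifP => lti; rewrite (nth_map h0) ?ltn_mod.
Qed.

(** * Generating functions *)

(** The coefficient of t^n in the sum of the c_i t^(k + 16i). *)
Fixpoint sparse (k : nat) (c : seq nat) (n : nat) : nat :=
  if c is a :: c' then a * (n == k) + sparse (k + 16) c' n else 0.

Lemma sparse_eq0 k c n : (forall i, n <> k + 16 * i) -> sparse k c n = 0.
Proof.
elim: c k => //= a c IH k ne; rewrite IH => [|i]; last by rewrite -addnA -mulnS; apply: ne.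
by case: eqP => [en|_]; [case: (ne 0); rewrite addn0 | rewrite muln0].
Qed.

Lemma sparseE k c i : sparse k c (k + 16 * i) = nth 0 c i.
Proof.
elim: c k i => [|a c IH] k [|i] //=.
  by rewrite addn0 eqxx muln1 sparse_eq0 ?addn0 // => j /eqP; rewrite -addnA -{1}[k]addn0 eqn_add2l.
by rewrite mulnS addnA IH -addnA -[X in _ == X]addn0 eqn_add2l muln0.
Qed.

(** Only n = 0 or 15 modulo 16 can contribute, and the two chains live in different classes. The
    summand [(n == 0)] is the empty lift, which precedes the chain starting at 16. *)
Lemma num_lifts_sparse u w c15 c16 n : 0 < size w ->
  has_counts u w 15 c15 -> has_counts u w 16 c16 ->
  num_lifts (preperiodic (map toZ4 u) (map toZ4 w)) n =
  (n == 0) + sparse 15 c15 n + sparse 16 c16 n.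
Proof.
move=> w_gt0 e15 e16; rewrite (num_liftsE (mkseq_preperiodic u n w_gt0)).
have mod15 i : (15 + 16 * i) %% 16 = 15 by rewrite addnC mulnC modnMDl.
have mod0 i : (16 + 16 * i) %% 16 = 0 by rewrite -mulnS modnMr.
have [n15 | n15] := eqVneq (n %% 16) 15.
  have -> : n = 15 + 16 * (n %/ 16) by rewrite {1}(divn_eq n 16) n15 addnC mulnC.
  rewrite (size_strong_lifts _ _ _ e15) // sparseE sparse_eq0 ?addn0 // => i.
  by move=> /(congr1 (modn^~ 16)); rewrite mod0 mod15.
have [n0 | n0] := eqVneq (n %% 16) 0; last first.
  rewrite strong_lifts_weight ?size_mkseq ?dvdn_weight ?negb_or ?n0 //.
  rewrite !sparse_eq0 => [|i en|i en].
  - by have [en|//] := eqVneq n 0; rewrite en in n0.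
  - by rewrite en mod0 in n0.
  by rewrite en mod15 in n15.
rewrite sparse_eq0 => [|i en]; last by rewrite en mod15 in n15.
rewrite (divn_eq n 16) n0; case: (n %/ 16) => [|q].
  by rewrite sparse_eq0 // strong_lifts_small.
by rewrite !addn0 mulSn mulnC sparseE (size_strong_lifts _ _ _ e16).
Qed.

Fixpoint sparse_poly (k : nat) (c : seq nat) : {poly int} :=
  if c is a :: c' then (a%:R * 'X^k + sparse_poly (k + 16) c')%R else 0%R.

Lemma coef_sparse_poly k c n : ((sparse_poly k c)`_n = (sparse k c n)%:Z)%R.
Proof.
elim: c k => [|a c IH] k /=; first by rewrite coef0.
rewrite coefD IH GRing.mulr_natl coefMn coefXn PoszD; congr (_ + _)%R.
by case: (n == k); rewrite ?muln1 ?natz // muln0 GRing.mul0rn.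
Qed.

Lemma genfun_sparse u w c15 c16 (p : {poly int}) : 0 < size w ->
  has_counts u w 15 c15 -> has_counts u w 16 c16 ->
  (p = 1 + sparse_poly 15 c15 + sparse_poly 16 c16)%R ->
  genfun (preperiodic (map toZ4 u) (map toZ4 w)) =1 fps_of_poly p.
Proof.
move=> w_gt0 e15 e16 -> n; rewrite /genfun (num_lifts_sparse _ w_gt0 e15 e16).
by rewrite /fps_of_poly !coefD !coef_sparse_poly coef1 !PoszD -natz.
Qed.

(** * The six sequences and their computed level sizes *)

Definition S1_head := [:: h0; h1; h2; h2; h0; h2; h3; h2].

Definition S1_period :=
  [:: h2; h1; h2; h1; h1; h3; h2; h2; h0; h0; h3; h0;
      h2; h3; h2; h3; h1; h1; h2; h0; h0; h2; h3; h2].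

Definition S2_head := [:: h2; h1; h2; h1; h0; h1; h3; h0].

Definition S2_period :=
  [:: h2; h0; h0; h1; h3; h2; h0; h2; h2; h1; h1; h2;
      h0; h0; h2; h1; h1; h0; h2; h2; h0; h1; h3; h0].

Definition T1_head := [:: h0; h1; h2; h0; h0; h2; h1].

Definition T1_period :=
  [:: h2; h1; h2; h2; h0; h2; h1; h0; h2; h0; h2; h3;
      h0; h3; h2; h2; h0; h0; h3; h2; h2; h0; h2; h1].

Definition T2_head := [:: h1; h0; h0; h0; h2; h1; h2].

Definition T2_period :=
  [:: h3; h1; h2; h2; h2; h3; h3; h0; h1; h2; h1; h0;
      h3; h1; h2; h0; h0; h3; h1; h0; h3; h2; h3; h2].

Definition T3_head := [:: h1; h2; h0; h0; h2; h1; h0].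

Definition T3_period :=
  [:: h2; h2; h0; h1; h0; h1; h2; h2; h2; h0; h3; h2;
      h2; h2; h2; h1; h0; h3; h0; h0; h0; h2; h1; h0].

Definition T4_head := [:: h2; h1; h0; h2; h2; h0; h3].

Definition T4_period :=
  [:: h2; h3; h2; h0; h0; h2; h1; h0; h2; h0; h2; h1;
      h2; h3; h0; h0; h2; h2; h3; h0; h2; h2; h0; h3].

(** The empty list says that the chain already dies at length 15. *)
Lemma S1_counts15 : has_counts S1_head S1_period 15 [::].
Proof. by vm_compute. Qed.

Lemma S1_counts16 : has_counts S1_head S1_period 16 [:: 16; 46; 32; 14].
Proof. by vm_compute. Qed.

Lemma S2_counts15 : has_counts S2_head S2_period 15 [::].
Proof. by vm_compute. Qed.

Lemma S2_counts16 : has_counts S2_head S2_period 16 [:: 22; 60; 56; 28; 6].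
Proof. by vm_compute. Qed.

Lemma T1_counts15 : has_counts T1_head T1_period 15 [:: 14; 40; 40; 24; 8; 2; 2].
Proof. by vm_compute. Qed.

Lemma T1_counts16 : has_counts T1_head T1_period 16 [::].
Proof. by vm_compute. Qed.

Lemma T2_counts15 : has_counts T2_head T2_period 15 [:: 30; 66; 76; 32; 12].
Proof. by vm_compute. Qed.

Lemma T2_counts16 : has_counts T2_head T2_period 16 [::].
Proof. by vm_compute. Qed.

Lemma T3_counts15 : has_counts T3_head T3_period 15 [:: 14; 54; 42; 34; 12; 2].
Proof. by vm_compute. Qed.

Lemma T3_counts16 : has_counts T3_head T3_period 16 [::].
Proof. by vm_compute. Qed.

Lemma T4_counts15 : has_counts T4_head T4_period 15 [:: 14; 54; 64; 40; 10; 2].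
Proof. by vm_compute. Qed.

Lemma T4_counts16 : has_counts T4_head T4_period 16 [::].
Proof. by vm_compute. Qed.

Lemma S1E : S1 = preperiodic (map toZ4 S1_head) (map toZ4 S1_period).
(* Elements of ['Z_4] carry bound proofs, so the lists are compared by boolean equality. *)
Proof. by congr preperiodic; apply/eqP; vm_compute. Qed.

Lemma S2E : S2 = preperiodic (map toZ4 S2_head) (map toZ4 S2_period).
Proof. by congr preperiodic; apply/eqP; vm_compute. Qed.

Lemma T1E : T1 = preperiodic (map toZ4 T1_head) (map toZ4 T1_period).
Proof. by congr preperiodic; apply/eqP; vm_compute. Qed.

Lemma T2E : T2 = preperiodic (map toZ4 T2_head) (map toZ4 T2_period).
Proof. by congr preperiodic; apply/eqP; vm_compute. Qed.

Lemma T3E : T3 = preperiodic (map toZ4 T3_head) (map toZ4 T3_period).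
Proof. by congr preperiodic; apply/eqP; vm_compute. Qed.

Lemma T4E : T4 = preperiodic (map toZ4 T4_head) (map toZ4 T4_period).
Proof. by congr preperiodic; apply/eqP; vm_compute. Qed.

Local Open Scope ring_scope.

Theorem theorem4 :
  genfun S1 =1 fps_of_poly (1 + 16 * 'X^16 + 46 * 'X^32 + 32 * 'X^48 + 14 * 'X^64) /\
  genfun S2 =1 fps_of_poly (1 + 22 * 'X^16 + 60 * 'X^32 + 56 * 'X^48 + 28 * 'X^64 + 6 * 'X^80) /\
  genfun T1 =1 fps_of_poly (1 + 14 * 'X^15 + 40 * 'X^31 + 40 * 'X^47 + 24 * 'X^63 + 8 * 'X^79 + 2 * 'X^95 + 2 * 'X^111) /\
  genfun T2 =1 fps_of_poly (1 + 30 * 'X^15 + 66 * 'X^31 + 76 * 'X^47 + 32 * 'X^63 + 12 * 'X^79) /\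
  genfun T3 =1 fps_of_poly (1 + 14 * 'X^15 + 54 * 'X^31 + 42 * 'X^47 + 34 * 'X^63 + 12 * 'X^79 + 2 * 'X^95) /\
  genfun T4 =1 fps_of_poly (1 + 14 * 'X^15 + 54 * 'X^31 + 64 * 'X^47 + 40 * 'X^63 + 10 * 'X^79 + 2 * 'X^95).
Proof.
rewrite S1E S2E T1E T2E T3E T4E; split; [|split; [|split; [|split; [|split]]]].
(* The zeros removed are the empty chain and the tail of [sparse_poly]. *)
- by apply: (genfun_sparse _ S1_counts15 S1_counts16) => //=; rewrite !(GRing.addr0, GRing.addrA).
- by apply: (genfun_sparse _ S2_counts15 S2_counts16) => //=; rewrite !(GRing.addr0, GRing.addrA).
- by apply: (genfun_sparse _ T1_counts15 T1_counts16) => //=; rewrite !(GRing.addr0, GRing.addrA).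
- by apply: (genfun_sparse _ T2_counts15 T2_counts16) => //=; rewrite !(GRing.addr0, GRing.addrA).
- by apply: (genfun_sparse _ T3_counts15 T3_counts16) => //=; rewrite !(GRing.addr0, GRing.addrA).
- by apply: (genfun_sparse _ T4_counts15 T4_counts16) => //=; rewrite !(GRing.addr0, GRing.addrA).
Qed.
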